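(* Let $I\subset\mathbb{R}$ be an interval, let $\gamma=(x,y):I\to\mathbb{R}^2$ be a $C^\infty$ curve with $y(t)>0$ for all $t\in I$, and let $s(t,\theta)=(x(t),y(t)\cos\theta,y(t)\sin\theta)$ be its surface of revolution. Let $(i,j)\in\{(2,3),(2,5),(3,4),(3,5)\}$, $p\in I$ and $\theta\in\mathbb{R}$. Then the map-germ $s$ at $(p,\theta)$ is a $j/i$-cuspidal edge if and only if the profile curve $\gamma$ at $p$ is a $j/i$-cusp.
   Context: Two $C^\infty$ map-germs $f_1,f_2:(\mathbb{R}^m,0)\to(\mathbb{R}^n,0)$ are $\mathcal{A}$-equivalent if there exist diffeomorphism-germs $S:(\mathbb{R}^m,0)\to(\mathbb{R}^m,0)$ and $T:(\mathbb{R}^n,0)\to(\mathbb{R}^n,0)$ such that $f_2\circ S=T\circ f_1$; germs at other points are compared after translating source and target points to the origin. A singular point $p$ of a plane curve $\gamma$ is a $j/i$-cusp if the map-germ $\gamma$ at $p$ is $\mathcal{A}$-equivalent to $t\mapsto(t^i,t^j)$ at $0$. A singular point $q$ of a map $f$ from a surface domain in $\mathbb{R}^2$ to $\mathbb{R}^3$ is a $j/i$-cuspidal edge if the map-germ $f$ at $q$ is $\mathcal{A}$-equivalent to $(u,v)\mapsto(u^i,u^j,v)$ at $0$. *)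

(* Defs.v *)
From HB Require Import structures.
From mathcomp Require Import all_boot all_order all_algebra.
From mathcomp Require Import all_classical all_reals all_analysis.

Set Implicit Arguments.
Unset Strict Implicit.
Unset Printing Implicit Defensive.

Import Order.TTheory GRing.Theory Num.Theory.
Import numFieldNormedType.Exports.

Local Open Scope classical_set_scope.
Local Open Scope ring_scope.

(* Map-germs are represented by total functions, of which only the restriction
   to some neighbourhood of the base point matters.  The spaces V and W below
   stand for finite-dimensional spaces R^m and R^n: the normed module R itself
   when the dimension is 1, and 'rV[R]_n otherwise. *)

(* Meant for an open set U. *)
Fixpoint Ck (R : realType) (V W : normedModType R) (k : nat) (U : set V)
    (f : V -> W) : Prop :=
  match k with
  | 0 => forall x, U x -> {for x, continuous f}
  | k'.+1 => (forall x, U x -> differentiable f x) /\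
             (forall v : V, Ck k' U (fun x => 'D_v f x))
  end.

(* C^oo on an arbitrary set A means C^oo on some open set containing A; in
   particular [smooth_on [set p] f] says that f is C^oo as a germ at p. *)
Definition smooth_on (R : realType) (V W : normedModType R) (A : set V)
    (f : V -> W) : Prop :=
  exists U : set V, [/\ open U, A `<=` U & forall k, Ck k U f].

Definition diffeo_germ (R : realType) (V : normedModType R) (S : V -> V)
    : Prop :=
  [/\ S 0 = 0, smooth_on [set 0] S &
   exists S' : V -> V,
     [/\ S' 0 = 0, smooth_on [set 0] S',
         \forall x \near (0 : V), S' (S x) = x &
         \forall x \near (0 : V), S (S' x) = x]].

Definition A_equivalent (R : realType) (V W : normedModType R)
    (f1 f2 : V -> W) : Prop :=
  exists (S : V -> V) (T : W -> W),
    [/\ diffeo_germ S, diffeo_germ T &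
        \forall x \near (0 : V), f2 (S x) = T (f1 x)].

Definition germ_at (R : realType) (V W : normedModType R) (f : V -> W) (p : V)
    : V -> W :=
  fun x => f (p + x) - f p.

(* f is not an immersion at p; for a curve this says that its velocity
   vanishes at p. *)
Definition singular_point (R : realType) (V W : normedModType R) (f : V -> W)
    (p : V) : Prop :=
  ~ injective ('d f p : V -> W).

Definition vec2 (R : realType) (a b : R) : 'rV[R]_2 :=
  \row_(k < 2) [:: a; b]`_k.

Definition vec3 (R : realType) (a b c : R) : 'rV[R]_3 :=
  \row_(k < 3) [:: a; b; c]`_k.

Definition is_cusp (R : realType) (j i : nat) (gamma : R -> 'rV[R]_2) (p : R)
    : Prop :=
  singular_point gamma p /\
  A_equivalent (germ_at gamma p) (fun t : R => vec2 (t ^+ i) (t ^+ j)).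

Definition is_cuspidal_edge (R : realType) (j i : nat)
    (f : 'rV[R]_2 -> 'rV[R]_3) (q : 'rV[R]_2) : Prop :=
  singular_point f q /\
  A_equivalent (germ_at f q)
    (fun w : 'rV[R]_2 =>
       let u := w ord0 ord0 in
       let v := w ord0 ord_max in
       vec3 (u ^+ i) (u ^+ j) v).

Definition plane_curve (R : realType) (x y : R -> R) : R -> 'rV[R]_2 :=
  fun t => vec2 (x t) (y t).

Definition surface_of_revolution (R : realType) (x y : R -> R)
    : 'rV[R]_2 -> 'rV[R]_3 :=
  fun w =>
    let t := w ord0 ord0 in
    let theta := w ord0 ord_max in
    vec3 (x t) (y t * cos theta) (y t * sin theta).

(* Main.v *)
(** A surface of revolution is, in cylindrical coordinates, the product of its
    profile curve with the angle, and these coordinates are regular since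
    [y > 0]; so the claim is that [gamma x id] is equivalent to [c x id], with
    [c u = (u^i, u^j)], iff [gamma] is equivalent to [c].  For the nontrivial
    direction let [(c x id) o D = E o (gamma x id)].  As [gamma' = 0] at the
    base point while [c'] vanishes only at 0, [D] maps the axis [{0} x R] to
    itself, and hence so does [E].  Therefore the slices [D(., 0)] and
    [E(., 0)], projected along this axis, are diffeomorphism germs (by the
    implicit function theorem for a scalar unknown), and they conjugate
    [gamma] to [c]. *)
From HB Require Import structures.
Require Import Defs.
From mathcomp Require Import all_boot all_order all_algebra.
From mathcomp Require Import all_classical all_reals all_analysis.
From mathcomp Require Import ring lra.
Import Order.TTheory GRing.Theory Num.Theory.
Import numFieldNormedType.Exports.
Local Open Scope classical_set_scope.
Local Open Scope ring_scope.
Set Implicit Arguments.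
Unset Strict Implicit.
Unset Printing Implicit Defensive.

(** * Calculus of C^k maps *)

(** A diffeomorphism germ of a product may mix the two factors, so an equivalence of the suspended
    germs does not visibly restrict to slices. What singles out the axis is the rank: at every point
    (0, z) the derivative of gamma x id kills the direction (1, 0). Differentiating the relation
    there along (1, 0) and using that dD is invertible forces c' to vanish at the first component of
    D(0, z).

    Inverting a slice is then one scalar equation rather than a system, because the inverse D' of D
    is already at hand: over each w it only remains to find the point of the line {w} x R that D'
    sends back into the slice. Preservation of the axis is exactly what makes this equation
    nondegenerate.

    Smoothness is phrased through iterated directional derivatives, so its closure properties, above
    all composition, have to be derived from formulas for these derivatives. *)

Lemma is_diff_eps (R : realType) (V W : normedModType R) (f : V -> W)
    (L : {linear V -> W}) (x : V) :
  continuous L ->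
  (forall e, 0 < e ->
     \forall h \near (0 : V), `|f (h + x) - f x - L h| <= e * `|h|) ->
  is_diff x f L.
Proof.
move=> cL H.
have E : f \o shift x = cst (f x) + L +o_ 0 id.
  apply/eqaddoP => e e0; apply: filterS (H e e0) => h /=.
  by rewrite !fctE /= opprD addrA.
have D := diff_unique cL E.
by apply: DiffDef => //; apply/diff_locallyP; rewrite D.
Qed.

Lemma diff_eps (R : realType) (V W : normedModType R) (f : V -> W) (x : V) :
  differentiable f x -> forall e, 0 < e ->
  \forall h \near (0 : V), `|f (h + x) - f x - 'd f x h| <= e * `|h|.
Proof.
move=> /diff_locally /eqaddoP H e e0; apply: filterS (H e e0) => h /=.
by rewrite !fctE /= opprD addrA.
Qed.

Lemma near_eq_differentiable (R : realType) (V W : normedModType R)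
    (f g : V -> W) (x : V) :
  (\forall y \near x, f y = g y) -> differentiable f x -> differentiable g x.
Proof.
move=> fg df.
suff : is_diff x g ('d f x) by move=> ?; exact: ex_diff.
apply: is_diff_eps; first exact: diff_continuous.
move=> e e0; rewrite -(nbhs_singleton fg).
have fg0 : \forall h \near (0 : V), f (h + x) = g (h + x).
  by move: fg; rewrite (near_shift 0) subr0.
by near=> h; rewrite -(near fg0 h)//; near: h; exact: diff_eps.
Unshelve. all: by end_near. Qed.

Section CkCalculus.
Context {R : realType}.
Implicit Types V W : normedModType R.

(** Since [U] is open, equality on [U] is equality near each of its points, and therefore passes to
    all directional derivatives. *)
Lemma Ck_ext V W k (U : set V) (f g : V -> W) : open U ->
  (forall x, U x -> f x = g x) -> Ck k U f -> Ck k U g.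
Proof.
move=> oU; elim: k f g => [|k IH] f g fg /=.
  move=> cf x Ux; change (g @ x --> g x); rewrite -(fg _ Ux).
  apply: cvg_trans (cf x Ux); apply: near_eq_cvg.
  by apply: filterS (open_nbhs_nbhs (conj oU Ux)) => y Uy; rewrite fg.
have nfg x : U x -> \forall y \near x, f y = g y.
  by move=> Ux; apply: filterS (open_nbhs_nbhs (conj oU Ux)) => y /fg.
move=> [df Df]; split=> [x Ux|v].
  exact: near_eq_differentiable (nfg _ Ux) (df x Ux).
apply: IH (Df v) => x Ux; exact/near_eq_derive/nfg.
Qed.

Lemma Ck_sub V W k (U U' : set V) (f : V -> W) :
  U' `<=` U -> Ck k U f -> Ck k U' f.
Proof.
move=> sU; elim: k f => [|k IH] f /=; first by move=> H x /sU; exact: H.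
by move=> [df Df]; split=> [x /sU/df//|v]; exact: IH.
Qed.

Lemma Ck_pred V W k (U : set V) (f : V -> W) : Ck k.+1 U f -> Ck k U f.
Proof.
elim: k f => [|k IH] f [df Df].
  by move=> x /df; exact: differentiable_continuous.
by split=> // v; exact/IH/Df.
Qed.

Lemma Ck_continuous V W k (U : set V) (f : V -> W) :
  Ck k U f -> forall x, U x -> {for x, continuous f}.
Proof. by elim: k => // k IH /Ck_pred. Qed.

Lemma Ck_cst V W k (U : set V) (c : W) : Ck k U (fun=> c).
Proof.
elim: k c => [|k IH] c /=; first by move=> x _; exact: cvg_cst.
split=> [x _|v]; first exact: differentiable_cst.
have -> : (fun x => 'D_v (fun=> c) x) = fun=> 0 :> W.
  by apply/funext => x; exact: derive_cst.
exact: IH.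
Qed.

Lemma Ck_add V W k (U : set V) (f g : V -> W) : open U ->
  Ck k U f -> Ck k U g -> Ck k U (fun x => f x + g x).
Proof.
move=> oU; elim: k f g => [|k IH] f g.
  by move=> cf cg x Ux; exact: (cvgD (cf x Ux) (cg x Ux)).
move=> [df Df] [dg Dg]; split=> [x Ux|v].
  by apply: differentiableD; [exact: df|exact: dg].
apply: Ck_ext (IH _ _ (Df v) (Dg v)) => // x Ux.
rewrite -deriveD//; apply: diff_derivable; first exact: df.
exact: dg.
Qed.

Lemma is_diff_linear V W (L : {linear V -> W}) (x : V) :
  continuous L -> is_diff x L L.
Proof.
by move=> cL; apply: DiffDef; [exact: linear_differentiable|exact: diff_lin].
Qed.

Lemma derive_linear_comp V W (W' : normedModType R) (f : V -> W)
    (L : {linear W -> W'}) (x v : V) : continuous L ->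
  differentiable f x -> 'D_v (fun x => L (f x)) x = L ('D_v f x).
Proof.
move=> cL df; have dL : differentiable L (f x) by exact: linear_differentiable.
rewrite (deriveE v df) [LHS]deriveE; last exact: differentiable_comp df dL.
by rewrite (diff_comp df dL) /= (diff_lin _ cL).
Qed.

Lemma Ck_linear_comp V W (W' : normedModType R) k (U : set V) (f : V -> W)
    (L : {linear W -> W'}) : open U -> continuous L ->
  Ck k U f -> Ck k U (fun x => L (f x)).
Proof.
move=> oU cL; elim: k f => [|k IH] f.
  by move=> cf x Ux; apply: continuous_comp; [exact: cf|exact: cL].
have dL y : differentiable L y by exact: linear_differentiable.
move=> [df Df]; split=> [x Ux|v].
  by apply: differentiable_comp; [exact: df|exact: dL].
apply: Ck_ext (IH _ (Df v)) => // x Ux.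
by rewrite derive_linear_comp//; exact: df.
Qed.

Lemma Ck_id V k (U : set V) : Ck k U (fun x : V => x).
Proof.
case: k => [|k]; first by move=> x _; exact: cvg_id.
split=> [x _|v]; first exact: (@ex_diff _ _ _ _ _ _ _ (is_diff_id x)).
have -> : (fun x => 'D_v (fun y : V => y) x) = fun=> v.
  by apply/funext => x; exact: derive_id.
exact: Ck_cst.
Qed.

Lemma Ck_linear V W k (U : set V) (L : {linear V -> W}) : open U ->
  continuous L -> Ck k U L.
Proof. by move=> oU cL; exact: (Ck_linear_comp oU cL (Ck_id k U)). Qed.

(* A named constant, so that it can carry a bilinear instance. *)
Definition smul W (a : R) (w : W) : W := a *: w.

Lemma smul_is_bilinear W : bilinear_for
    (GRing.Scale.Law.clone _ _ *:%R _) (GRing.Scale.Law.clone _ _ *:%R _)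
    (@smul W).
Proof.
rewrite /smul; split=> [w|a] b x y /=; first by rewrite scalerDl scalerA.
by rewrite scalerDr !scalerA mulrC.
Qed.

HB.instance Definition _ W := bilinear_isBilinear.Build R R W W _ _
  (@smul W) (@smul_is_bilinear W).

Lemma is_diff_scale V W (a : V -> R) (f : V -> W) x :
  differentiable a x -> differentiable f x ->
  is_diff x (fun x => a x *: f x) (fun v => a x *: 'd f x v + 'd a x v *: f x).
Proof.
move=> da df.
have cs : continuous (fun p : R * W => p.1 *: p.2).
  by move=> p; exact: scale_continuous.
pose b : {bilinear R -> W -> W} := @smul W.
have db := @differentiable_bilin _ _ _ _ b (a x, f x) cs.
have dp := differentiable_pair da df.
apply: DiffDef; first exact: (differentiable_comp dp db).
rewrite (diff_comp dp db) (@diff_bilin _ _ _ _ b _ cs) diff_pair//.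
Qed.

Lemma Ck_scale V W k (U : set V) (a : V -> R) (f : V -> W) : open U ->
  Ck k U a -> Ck k U f -> Ck k U (fun x => a x *: f x).
Proof.
move=> oU; elim: k a f => [|k IH] a f.
  by move=> ca cf x Ux; exact: (cvgZ (ca x Ux) (cf x Ux)).
move=> Ca Cf; have [[da Da] [df Df]] := (Ca, Cf); split=> [x Ux|v].
  by have := is_diff_scale (da x Ux) (df x Ux) => ?; exact: ex_diff.
have C1 := IH _ _ (Ck_pred Ca) (Df v).
have C2 := IH _ _ (Da v) (Ck_pred Cf).
apply: Ck_ext (Ck_add oU C1 C2) => // x Ux.
have D := is_diff_scale (da x Ux) (df x Ux).
rewrite (deriveE v (df x Ux)) (deriveE v (da x Ux)).
by rewrite (deriveE v (ex_diff (is_diff_def := D))) diff_val.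
Qed.

(* [Ck] only speaks of directional derivatives; a finite frame of the middle
   space expresses those of [g \o f] through those of [f] and [g]. *)
Definition finite_frame V := exists (n : nat) (e : 'I_n -> V)
  (c : 'I_n -> {linear V -> R}),
  (forall i, continuous (c i)) /\ (forall v, v = \sum_i c i v *: e i).

(** Induction on [k], for all [f] and [g] at once: a directional derivative of the composite is a
    finite sum of products in which [g] is replaced by its derivatives along the frame, while [f]
    stays and loses one order by [Ck_pred]. *)
Lemma Ck_comp V W (W' : normedModType R) k (U : set V) (U' : set W)
    (f : V -> W) (g : W -> W') :
  finite_frame W -> open U -> open U' -> (forall x, U x -> U' (f x)) ->
  Ck k U f -> Ck k U' g -> Ck k U (fun x => g (f x)).
Proof.
move=> [n [e [c [cc ce]]]] oU oU' sU; elim: k g f sU => [|k IH] g f sU.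
  by move=> cf cg x Ux; apply: continuous_comp; [exact: cf|exact/cg/sU].
move=> Cf Cg; have [[df Df] [dg Dg]] := (Cf, Cg); split=> [x Ux|v].
  by apply: differentiable_comp; [exact: df|exact/dg/sU].
have Csum m (F : 'I_m -> V -> W') : (forall i, Ck k U (F i)) ->
    Ck k U (fun x => \sum_i F i x).
  elim: m F => [|m IHm] F CF.
    rewrite (_ : (fun x => _) = fun=> 0); first exact: Ck_cst.
    by apply/funext => x; rewrite big_ord0.
  rewrite (_ : (fun x => _) =
      fun x => \sum_(i < m) F (widen_ord (leqnSn m) i) x + F ord_max x).
    by apply: Ck_add => //; exact: IHm.
  by apply/funext => x; rewrite big_ord_recr.
(* The chain rule with ['D_v f x] expanded in the frame, so that only derivatives of [g] in fixed
   directions occur. *)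
suff : Ck k U (fun x => \sum_i c i ('D_v f x) *: 'D_(e i) g (f x)).
  apply: Ck_ext => // x Ux.
  have [dfx dgx] := (df x Ux, dg _ (sU x Ux)).
  rewrite [RHS]deriveE; last exact: differentiable_comp.
  rewrite [RHS](_ : _ = ('d g (f x) \o 'd f x) v); last first.
    by rewrite -diff_comp.
  rewrite /= -(deriveE v dfx) [in RHS](ce ('D_v f x)) raddf_sum.
  apply: eq_bigr => i _; rewrite (deriveE _ dgx); symmetry; exact: linearZZ.
apply: Csum => i; apply: Ck_scale => //.
  exact: (Ck_linear_comp oU (cc i) (Df v)).
exact: (IH _ _ sU (Ck_pred Cf) (Dg (e i))).
Qed.

End CkCalculus.

(** * Smooth germs *)

Section SmoothGerms.
Context {R : realType}.
Implicit Types V W : normedModType R.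

Lemma finite_frame_real : finite_frame R.
Proof.
exists 1%N, (fun=> 1), (fun=> idfun); split=> [_ x|v].
  exact: cvg_id.
by rewrite big_ord1 /= [RHS]mulr1.
Qed.

Definition row_coord n (i : 'I_n) (w : 'rV[R]_n) : R := w ord0 i.

Lemma row_coord_is_linear n (i : 'I_n) : linear (row_coord i).
Proof. by move=> a u v; rewrite /row_coord !mxE. Qed.

HB.instance Definition _ n (i : 'I_n) :=
  GRing.isLinear.Build R 'rV[R]_n R _ (row_coord i) (row_coord_is_linear i).

Lemma row_coord_continuous n (i : 'I_n) : continuous (row_coord i).
Proof. exact: coord_continuous. Qed.

Lemma finite_frame_row n : finite_frame 'rV[R]_n.
Proof.
exists n, (fun i => delta_mx 0 i), (fun i => row_coord i).
by split=> [i|v]; [exact: row_coord_continuous|exact: row_sum_delta].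
Qed.

Lemma fst_continuous V W : continuous (fst : V * W -> V).
Proof. by move=> x; exact: cvg_fst. Qed.

Lemma snd_continuous V W : continuous (snd : V * W -> W).
Proof. by move=> x; exact: cvg_snd. Qed.

Lemma finite_frame_prod V W : finite_frame V -> finite_frame W ->
  finite_frame (V * W)%type.
Proof.
move=> [n [e [c [cc ce]]]] [m [f [d [dc df]]]].
exists (n + m)%N, (fun i => match fintype.split i with
    | inl j => (e j, 0) | inr j => (0, f j) end).
exists (fun i => match fintype.split i with
    | inl j => (c j \o fst : {linear (V * W)%type -> R})
    | inr j => (d j \o snd : {linear (V * W)%type -> R}) end).
split=> [i|[v w]].
  case: (fintype.split i) => j x; apply: continuous_comp.
  - exact: fst_continuous.
  - exact: cc.
  - exact: snd_continuous.
  - exact: dc.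
rewrite big_split_ord /=.
under eq_bigr do rewrite (unsplitK (inl _ _)) /=.
under [X in _ + X]eq_bigr do rewrite (unsplitK (inr _ _)) /=.
have fstD k (F : 'I_k -> V * W) : (\sum_i F i).1 = \sum_i (F i).1.
  exact: (raddf_sum (fst : {linear (V * W)%type -> V})).
have sndD k (F : 'I_k -> V * W) : (\sum_i F i).2 = \sum_i (F i).2.
  exact: (raddf_sum (snd : {linear (V * W)%type -> W})).
rewrite [RHS]surjective_pairing; congr pair.
  rewrite [RHS](_ : _ = (\sum_(i < n) c i v *: ((e i, 0) : V * W)).1 +
     (\sum_(i < m) d i w *: ((0, f i) : V * W)).1)// !fstD.
  rewrite [X in _ + X]big1 ?addr0; first exact: ce.
  by move=> i _; exact: scaler0.
rewrite [RHS](_ : _ = (\sum_(i < n) c i v *: ((e i, 0) : V * W)).2 +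
   (\sum_(i < m) d i w *: ((0, f i) : V * W)).2)// !sndD.
rewrite big1 ?add0r; first exact: df.
by move=> i _; exact: scaler0.
Qed.

Lemma Ck_pair V W (W' : normedModType R) k (U : set V) (f : V -> W)
    (g : V -> W') : open U ->
  Ck k U f -> Ck k U g -> Ck k U (fun x => (f x, g x)).
Proof.
move=> oU; elim: k f g => [|k IH] f g.
  by move=> cf cg x Ux; exact: (cvg_pair (cf x Ux) (cg x Ux)).
move=> [df Df] [dg Dg]; split=> [x Ux|v].
  by apply: differentiable_pair; [exact: df|exact: dg].
apply: Ck_ext (IH _ _ (Df v) (Dg v)) => // x Ux.
have [dfx dgx] := (df x Ux, dg x Ux).
rewrite (deriveE v dfx) (deriveE v dgx).
by rewrite (deriveE v (differentiable_pair dfx dgx)) diff_pair.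
Qed.

Lemma smooth_onP V W (A : set V) (f : V -> W) (p : V) : A p ->
  smooth_on A f -> smooth_on [set p] f.
Proof.
move=> Ap [U [oU sU CU]]; exists U; split=> // x -> /=; exact: sU.
Qed.

Lemma smooth_at_open V W (U : set V) (f : V -> W) (p : V) : open U -> U p ->
  (forall k, Ck k U f) -> smooth_on [set p] f.
Proof. by move=> oU Up CU; exists U; split=> // x ->. Qed.

Lemma smooth_at_nbhs V W (f : V -> W) (p : V) : smooth_on [set p] f ->
  exists U, [/\ open U, U p & forall k, Ck k U f].
Proof. by move=> [U [oU sU CU]]; exists U; split=> //; exact: sU. Qed.

Lemma smooth_near V W (f : V -> W) (p : V) : smooth_on [set p] f ->
  \forall x \near p, smooth_on [set x] f.
Proof.
move=> /smooth_at_nbhs[U [oU Up CU]].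
apply: filterS (open_nbhs_nbhs (conj oU Up)) => x Ux.
exact: smooth_at_open oU Ux CU.
Qed.

Lemma smooth_differentiable V W (f : V -> W) (p : V) :
  smooth_on [set p] f -> differentiable f p.
Proof. by move=> /smooth_at_nbhs[U [oU Up /(_ 1%N)[/(_ p Up)]]]. Qed.

Lemma smooth_continuous V W (f : V -> W) (p : V) :
  smooth_on [set p] f -> f @ p --> f p.
Proof. by move=> /smooth_differentiable/differentiable_continuous. Qed.

Lemma smooth_ext V W (f g : V -> W) (p : V) :
  (\forall x \near p, f x = g x) -> smooth_on [set p] f -> smooth_on [set p] g.
Proof.
move=> fg /smooth_at_nbhs[U [oU Up CU]].
have oI : open (U `&` (fun x => f x = g x)°) by apply: openI => //; exact: open_interior.
apply: (smooth_at_open oI) => [|k]; first by split.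
apply: (Ck_ext oI _ (Ck_sub (@subIsetl _ _ _) (CU k))) => x [_].
exact: interior_subset.
Qed.

Lemma smooth_comp V W (W' : normedModType R) (f : V -> W) (g : W -> W')
    (p : V) : finite_frame W ->
  smooth_on [set p] f -> smooth_on [set f p] g ->
  smooth_on [set p] (fun x => g (f x)).
Proof.
move=> fr /smooth_at_nbhs[U [oU Up CU]] /smooth_at_nbhs[U' [oU' Up' CU']].
have oI : open (U `&` f @^-1` U').
  rewrite openE => x [Ux Ufx]; apply: filterI; first exact: open_nbhs_nbhs.
  exact: (Ck_continuous (CU 0%N) Ux (open_nbhs_nbhs (conj oU' Ufx))).
apply: (smooth_at_open oI) => // k.
apply: (Ck_comp fr oI oU' _ _ (CU' k)) => [x []//|].
exact: Ck_sub (@subIsetl _ _ _) (CU k).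
Qed.

Lemma smooth_cst V W (c : W) (p : V) : smooth_on [set p] (fun=> c).
Proof. by apply: (smooth_at_open openT) => // k; exact: Ck_cst. Qed.

Lemma smooth_id V (p : V) : smooth_on [set p] (fun x : V => x).
Proof. by apply: (smooth_at_open openT) => // k; exact: Ck_id. Qed.

Lemma smooth_linear V W (L : {linear V -> W}) (p : V) : continuous L ->
  smooth_on [set p] L.
Proof.
by move=> cL; apply: (smooth_at_open openT) => // k; exact: Ck_linear openT cL.
Qed.

Lemma smooth_fst V W (q : V * W) : smooth_on [set q] (fun p : V * W => p.1).
Proof. exact: (smooth_linear (L := fst) q (@fst_continuous V W)). Qed.

Lemma smooth_snd V W (q : V * W) : smooth_on [set q] (fun p : V * W => p.2).
Proof. exact: (smooth_linear (L := snd) q (@snd_continuous V W)). Qed.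

Lemma smooth_pair V W (W' : normedModType R) (f : V -> W) (g : V -> W')
    (p : V) : smooth_on [set p] f -> smooth_on [set p] g ->
  smooth_on [set p] (fun x => (f x, g x)).
Proof.
move=> /smooth_at_nbhs[U [oU Up CU]] /smooth_at_nbhs[U' [oU' Up' CU']].
have oI := openI oU oU'.
apply: (smooth_at_open oI) => // k.
by apply: Ck_pair => //; [exact: Ck_sub (CU k)|exact: Ck_sub (CU' k)].
Qed.

Lemma smooth_add V W (f g : V -> W) (p : V) :
  smooth_on [set p] f -> smooth_on [set p] g ->
  smooth_on [set p] (fun x => f x + g x).
Proof.
move=> /smooth_at_nbhs[U [oU Up CU]] /smooth_at_nbhs[U' [oU' Up' CU']].
have oI := openI oU oU'.
apply: (smooth_at_open oI) => // k.
by apply: Ck_add => //; [exact: Ck_sub (CU k)|exact: Ck_sub (CU' k)].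
Qed.

Lemma smooth_scale V W (a : V -> R) (f : V -> W) (p : V) :
  smooth_on [set p] a -> smooth_on [set p] f ->
  smooth_on [set p] (fun x => a x *: f x).
Proof.
move=> /smooth_at_nbhs[U [oU Up CU]] /smooth_at_nbhs[U' [oU' Up' CU']].
have oI := openI oU oU'.
apply: (smooth_at_open oI) => // k.
by apply: Ck_scale => //; [exact: Ck_sub (CU k)|exact: Ck_sub (CU' k)].
Qed.

Lemma smooth_mul V (a b : V -> R) (p : V) :
  smooth_on [set p] a -> smooth_on [set p] b ->
  smooth_on [set p] (fun x => a x * b x).
Proof. exact: smooth_scale. Qed.

Lemma smooth_opp V W (f : V -> W) (p : V) :
  smooth_on [set p] f -> smooth_on [set p] (fun x => - f x).
Proof.
move=> sf; have -> : (fun x => - f x) = fun x => (-1 : R) *: f x.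
  by apply/funext => x; rewrite scaleN1r.
by apply: smooth_scale => //; exact: smooth_cst.
Qed.

(** On the line ['D_v f] is [v] times the ordinary derivative, so a single derivative controls all
    directions. This is the bootstrap for functions whose derivative is expressed through functions
    already treated. *)
Lemma Ck_real k (U : set R) (f f' : R -> R) : open U ->
  (forall x, U x -> is_derive x 1 f (f' x)) -> Ck k U f' -> Ck k.+1 U f.
Proof.
move=> oU df Cf'; have dif x : U x -> differentiable f x.
  by move=> /df[? _]; exact/derivable1_diffP.
split=> // v; apply: Ck_ext (Ck_scale oU (Ck_cst k U v) Cf') => // x Ux.
have [_ <-] := df x Ux.
by rewrite !(deriveE _ (dif x Ux)) -linearZZ [v *: 1]mulr1.
Qed.

(** The derivative is minus the square of the function itself, so the induction feeds on its own
    conclusion. *)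
Lemma Ck_inv k : Ck k [set x : R | x != 0] GRing.inv.
Proof.
have oU : open [set x : R | x != 0] by exact: open_neq.
elim: k => [|k IH].
  by move=> x /= x0; apply: differentiable_continuous; exact: differentiable_Rinv.
have C2 := Ck_scale oU (Ck_cst k _ (-1 : R)) (Ck_scale oU IH IH).
apply: (Ck_real oU _ C2) => x /= x0.
have dx := differentiable_Rinv x0.
apply: DeriveDef; first exact: diff_derivable.
rewrite deriveE// diff_Rinv// scaleN1r scaleNr; congr (- _).
by rewrite [LHS]mulr1 expr2 invfM.
Qed.

Lemma smooth_inv V (f : V -> R) (p : V) :
  smooth_on [set p] f -> f p != 0 -> smooth_on [set p] (fun x => (f x)^-1).
Proof.
move=> sf fp0; apply: (smooth_comp finite_frame_real sf).
have oU : open [set x : R | x != 0] by exact: open_neq.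
exact: (smooth_at_open oU fp0 Ck_inv).
Qed.

(** The two are proved together because each is, up to sign, the derivative of the other. *)
Lemma Ck_sin_cos k : Ck k setT (@sin R) /\ Ck k setT (@cos R).
Proof.
elim: k => [|k [Cs Cc]].
  by split=> x _; [exact: continuous_sin|exact: continuous_cos].
split; first exact: (Ck_real openT _ Cc).
apply: (Ck_real openT _ (Ck_scale openT (Ck_cst k setT (-1 : R)) Cs)) => x _.
by rewrite scaleN1r; exact: is_derive_cos.
Qed.

Lemma smooth_sin (p : R) : smooth_on [set p] sin.
Proof. by apply: (smooth_at_open openT) => // k; have [] := Ck_sin_cos k. Qed.

Lemma smooth_cos (p : R) : smooth_on [set p] cos.
Proof. by apply: (smooth_at_open openT) => // k; have [] := Ck_sin_cos k. Qed.

Lemma smooth_atan (p : R) : smooth_on [set p] atan.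
Proof.
have sd x : smooth_on [set x] (fun x : R => (1 + x * x)^-1).
  apply: smooth_inv; last by rewrite gt_eqF// ltr_pwDl// -expr2 sqr_ge0.
  apply: smooth_add; first exact: smooth_cst.
  by apply: smooth_mul; exact: smooth_id.
have [U [oU Up CU]] := smooth_at_nbhs (sd p).
apply: (smooth_at_open oU) => // k; apply: Ck_pred.
apply: (Ck_real oU _ (CU k)) => x _; rewrite -expr2; exact: is_derive1_atan.
Qed.

End SmoothGerms.

(** * The implicit function theorem for a scalar unknown *)

Section ImplicitFunction.
Context {R : realType} {W : normedModType R}.

Local Notation vert := ((0, 1) : W * R).

Lemma is_diff_inl (w : W) (z : R) :
  is_diff w (fun w => (w, z) : W * R) (fun k => (k, 0)).
Proof. exact: is_diff_pair. Qed.

Lemma is_diff_inr (w : W) (z : R) :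
  is_diff z (fun z => (w, z) : W * R) (fun k => (0, k)).
Proof. exact: is_diff_pair. Qed.

Lemma is_derive_slice (V : normedModType R) (g : W * R -> V) (w : W) (z : R) :
  differentiable g (w, z) ->
  is_derive z 1 (fun z => g (w, z)) ('D_vert g (w, z)).
Proof.
move=> dg; have di := is_diff_inr w z.
have dc := differentiable_comp (ex_diff (is_diff_def := di)) dg.
apply: DeriveDef; first exact: diff_derivable.
rewrite (deriveE _ dc) (deriveE _ dg).
by rewrite (diff_comp (ex_diff (is_diff_def := di)) dg) /= diff_val.
Qed.

(** Let [d k] be the increment of [h]. As [g] vanishes at both ends, its linear part at [(k, d k)],
    which equals [a * (d k - L k)], is bounded by the remainder of [g]; continuity of [h] keeps
    [(k, d k)] small enough for this. The remainder is relative to the norm of [(k, d k)], hence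
    involves [d k] itself, which must be absorbed. *)
Lemma implicit_is_diff (g : W * R -> R) (h : W -> R) (w : W) :
  {for w, continuous h} -> differentiable g (w, h w) ->
  'D_vert g (w, h w) != 0 ->
  (\forall x \near w, g (x, h x) = 0) ->
  differentiable h w /\
  forall v, 'D_v h w = - ('D_vert g (w, h w))^-1 * 'D_(v, 0) g (w, h w).
Proof.
move=> ch dg; set a := 'D_vert g _ => a0 gh.
pose A := 'd g (w, h w).
have Ea : A vert = a by rewrite /a deriveE.
pose l (k : W) := - a^-1 * A (k, 0).
have lin_l : linear l.
  move=> c u v; rewrite /l.
  have -> : (c *: u + v, 0) = c *: (u, 0) + (v, 0) :> W * R.
    by apply/pair_equal_spec; split; rewrite //= scaler0 addr0.
  by rewrite linearP /= mulrDr [c *: _]scalerAr.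
pose L : {linear W -> R} := HB.pack l (GRing.isLinear.Build _ _ _ _ _ lin_l).
have cL : continuous L.
  move=> k; apply: cvgM; first exact: cvg_cst.
  have di := is_diff_inl k 0.
  apply: (continuous_comp (f := fun k => (k, 0) : W * R)).
    exact/differentiable_continuous/(ex_diff (is_diff_def := di)).
  exact: diff_continuous.
suff D : is_diff w h L.
  split=> [|v]; first exact: ex_diff.
  by rewrite deriveE// diff_val /= /l -deriveE.
have [C C0 LC] := linear_lipschitz cL.
apply: is_diff_eps => // e e0.
(* [C] bounds [L]. The bound [2^-1] absorbs [d k] and yields [|k| + |d k| <= (2 + 2 * C) * |k|]; the
   other bound then leaves exactly [e * |k|]. The factor [|a|] cancels the coefficient of
   [d k - L k]. *)
pose e1 := `|a| * Num.min 2^-1 (e / (2 + 2 * C)).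
have C2 : 0 < 2 + 2 * C by lra.
have e10 : 0 < e1 by rewrite mulr_gt0 ?normr_gt0// lt_min invr_gt0 ltr0n divr_gt0.
pose d k := h (k + w) - h w.
have cd : (fun k : W => (k, d k) : W * R) @ (0 : W) --> ((0 : W), (0 : R)).
  suff cd : d @ (0 : W) --> (0 : R) by exact: (cvg_pair cvg_id cd).
  rewrite -(subrr (h w)); apply: cvgB; last exact: cvg_cst.
  have : h \o shift w @ (0 : W) --> h w.
    by rewrite cvg_comp_shift add0r.
  by [].
have gh0 : \forall k \near (0 : W), g (k + w, h (k + w)) = 0.
  by move: gh; rewrite (near_shift 0) subr0.
have ghw : g (w, h w) = 0 by exact: nbhs_singleton gh.
have := cd _ (diff_eps dg e10); rewrite /= near_simpl => H.
near=> k.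
have : `|A (k, d k)| <= e1 * `|(k, d k) : W * R|.
  rewrite -normrN -sub0r -[X in X - _](subrr (g (w, h w))) {1}ghw.
  have <- : g ((k, d k) + (w, h w)) = 0.
    rewrite -[RHS](near gh0 k)//; congr g; apply/pair_equal_spec.
    by split=> //=; rewrite /d subrK.
  by near: k.
have -> : A (k, d k) = a * (d k - L k).
  have -> : (k, d k) = (k, 0) + d k *: vert :> W * R.
    apply/pair_equal_spec; split; rewrite /= ?scaler0 ?addr0 ?add0r//.
    by rewrite [RHS]mulr1.
  rewrite linearD linearZ /= Ea /l.
  by rewrite mulrBr mulrA mulrN mulfV// mulN1r opprK addrC [d k *: a]mulrC.
rewrite normrM /e1 -mulrA ler_pM2l ?normr_gt0// => Hk.
have n0 : `|(k, d k) : W * R| <= `|k| + `|d k|.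
  by rewrite prod_normE ge_max /= lerDl lerDr !normr_ge0.
have m0 : 0 <= `|(k, d k) : W * R| by exact: normr_ge0.
have E1 : `|d k - L k| <= 2^-1 * (`|k| + `|d k|).
  apply: le_trans Hk _; apply: ler_pM => //.
    by rewrite ltW// lt_min invr_gt0 ltr0n divr_gt0.
  by rewrite ge_min lexx.
have E2 : `|d k - L k| <= e / (2 + 2 * C) * (`|k| + `|d k|).
  apply: le_trans Hk _; apply: ler_pM => //.
    by rewrite ltW// lt_min invr_gt0 ltr0n divr_gt0.
  by rewrite ge_min lexx orbT.
have E3 : `|d k| <= `|d k - L k| + C * `|k|.
  by rewrite -{1}(subrK (L k) (d k)) (le_trans (ler_normD _ _))// lerD2l.
have E4 : `|k| + `|d k| <= (2 + 2 * C) * `|k| by nra.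
rewrite -/(d k) (le_trans E2)// -mulrA ler_pM2l// -ler_pdivlMl ?invr_gt0//.
by rewrite invrK.
Unshelve. all: by end_near. Qed.

(** Bootstrap: the formula for ['D_v h] contains only derivatives of [g] at [(w, h w)], so class [k]
    of [h] gives class [k] of its derivatives, that is, class [k.+1] of [h]. *)
Lemma implicit_Ck (g : W * R -> R) (h : W -> R) (N : set W)
    (U : set (W * R)) : finite_frame W -> open N -> open U ->
  (forall w, N w -> [/\ {for w, continuous h}, U (w, h w) & g (w, h w) = 0]) ->
  (forall q, U q -> 'D_vert g q != 0) ->
  (forall k, Ck k U g) -> forall k, Ck k N h.
Proof.
move=> fr oN oU hN D0 Cg; elim=> [|k IH]; first by move=> w /hN[].
have H w : N w -> differentiable h w /\
  forall v, 'D_v h w = - ('D_vert g (w, h w))^-1 * 'D_(v, 0) g (w, h w).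
  move=> Nw; have [cw Uw gw] := hN w Nw.
  apply: implicit_is_diff => //; [|exact: D0|].
    by have [dg _] := Cg 1%N; exact: dg.
  by apply: filterS (open_nbhs_nbhs (conj oN Nw)) => x /hN[].
split=> [w /H[]//|v].
have Cp : Ck k N (fun w => (w, h w) : W * R) by apply: Ck_pair => //; exact: Ck_id.
have frp := finite_frame_prod fr (@finite_frame_real R).
have CD u : Ck k N (fun w => 'D_u g (w, h w)).
  have [_ Dg] := Cg k.+1.
  by apply: (Ck_comp frp oN oU _ Cp (Dg u)) => w /hN[].
have oneq : open [set x : R | x != 0] by exact: open_neq.
have CI : Ck k N (fun w => ('D_vert g (w, h w))^-1).
  apply: (Ck_comp (@finite_frame_real R) oN oneq _ (CD _) (Ck_inv k)) => w Nw.
  by apply: D0; have [] := hN w Nw.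
have C1 := Ck_scale oN (Ck_cst k N (-1 : R)) (Ck_scale oN CI (CD (v, 0))).
apply: (Ck_ext oN _ C1) => w Nw; have [_ ->] := H w Nw.
by rewrite scaleN1r mulNr.
Qed.

(** A positive vertical derivative makes [g (w, _)] strictly increasing near 0. The intermediate
    value theorem then gives a root and monotonicity its uniqueness, so no fixed-point argument is
    involved. *)
Lemma implicit_function_pos (g : W * R -> R) : finite_frame W ->
  smooth_on [set 0] g -> g 0 = 0 -> 0 < 'D_vert g 0 ->
  exists h : W -> R, [/\ h 0 = 0, smooth_on [set 0] h,
    \forall w \near (0 : W), g (w, h w) = 0 &
    \forall q \near (0 : W * R), g q = 0 -> q.2 = h q.1].
Proof.
move=> fr /smooth_at_nbhs[U [oU U0 CU]] g0 Dg0.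
have [_ /(_ vert) CDg] := CU 1%N.
have : \forall q \near (0 : W * R), U q /\ 0 < 'D_vert g q.
  apply: filterI; first exact: open_nbhs_nbhs.
  exact: (cvgr_gt _ (CDg _ U0) _ Dg0).
move=> /nbhs_normP[e /= e0 He].
have UD w z : `|w| < e -> `|z| < e -> U (w, z) /\ 0 < 'D_vert g (w, z).
  by move=> we ze; apply: He; rewrite /= sub0r normrN prod_normE gt_max we ze.
have dg w z : `|w| < e -> `|z| < e -> differentiable g (w, z).
  by move=> we ze; have [dg _] := CU 1%N; apply: dg; have [] := UD w z we ze.
have mono w z1 z2 : `|w| < e -> `|z1| < e -> `|z2| < e -> z1 < z2 ->
    g (w, z1) < g (w, z2).
  move=> we z1e z2e z12.
  have De z : z \in `]-e, e[ -> is_derive z 1 (fun z => g (w, z)) ('D_vert g (w, z)).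
    by rewrite in_itv/= -ltr_norml => ze; exact/is_derive_slice/dg.
  have : {in `]-e, e[ &, {homo (fun z => g (w, z)) : x y / x < y}}.
    apply: gtr0_derive1_lt_oo => [z /De[]//|z zi|z].
      rewrite derive1E; have [_ ->] := De z zi.
      by apply: (UD _ _ we _).2; move: zi; rewrite in_itv/= -ltr_norml.
    rewrite inE => /De[+ _]; move=> /derivable1_diffP; exact: differentiable_continuous.
  by apply => //; rewrite in_itv/= -ltr_norml.
have uniq w z1 z2 : `|w| < e -> `|z1| < e -> `|z2| < e ->
    g (w, z1) = 0 -> g (w, z2) = 0 -> z1 = z2.
  move=> we z1e z2e g1 g2; case: (ltgtP z1 z2) => // z12.
    by have := mono w z1 z2 we z1e z2e z12; rewrite g1 g2 ltxx.
  by have := mono w z2 z1 we z2e z1e z12; rewrite g1 g2 ltxx.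
have cw w z : `|w| < e -> `|z| < e -> (fun w => g (w, z)) @ w --> g (w, z).
  move=> we ze; have di := is_diff_inl w z.
  apply: (continuous_comp (f := fun w => (w, z) : W * R)).
    exact/differentiable_continuous/(ex_diff (is_diff_def := di)).
  exact/differentiable_continuous/dg.
have e2 : `|e / 2| < e by rewrite gtr0_norm; lra.
have e2N : `|- (e / 2)| < e by rewrite normrN.
(* The parameters for which [g (w, _)] changes sign. The endpoints are taken at half the radius,
   where [g] is still under control. *)
pose N := [set w : W | [/\ `|w| < e, 0 < g (w, e / 2) & g (w, - (e / 2)) < 0]].
have oN : open N.
  rewrite openE => w [we gp gn]; rewrite /interior /=; near=> x; split.
  - near: x; apply: (cvgr_lt _ _ _ we); exact: norm_continuous.
  - near: x; exact: (cvgr_gt _ (cw _ _ we e2) _ gp).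
  - near: x; exact: (cvgr_lt _ (cw _ _ we e2N) _ gn).
have N0 : N 0.
  rewrite /N /= normr0; split=> //.
    by rewrite -[X in X < _]g0; apply: mono; rewrite ?normr0//; lra.
  by rewrite -[X in _ < X]g0; apply: mono; rewrite ?normr0//; lra.
(* The default 0 of [xget] is never the reason for the value on [N], where a root exists. *)
pose h w := xget 0 [set z : R | `|z| < e /\ g (w, z) = 0].
have hP w : N w -> `|h w| < e /\ g (w, h w) = 0.
  move=> [we gp gn].
  have e2le : - (e / 2) <= e / 2 by lra.
  have [||c] := @IVT R (fun z => g (w, z)) _ _ 0 e2le.
  - apply: continuous_in_subspaceT => z; rewrite inE /= in_itv/= => /andP[z1 z2].
    have ze : `|z| < e by rewrite ltr_norml; lra.
    have [+ _] := is_derive_slice (dg w z we ze).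
    move=> /derivable1_diffP; exact: differentiable_continuous.
  - by rewrite ge_min le_max (ltW gn) (ltW gp) orbT.
  rewrite in_itv/= => /andP[c1 c2] gc.
  have ce : `|c| < e by rewrite ltr_norml; lra.
  by rewrite /h; case: xgetP => [z _ []//|/(_ c)]; case.
have hu w z : N w -> `|z| < e -> g (w, z) = 0 -> z = h w.
  move=> Nw ze gz; have [he gh] := hP w Nw.
  by case: Nw => we _ _; exact: uniq gz gh.
have ch w : N w -> {for w, continuous h}.
  move=> Nw; have [hwe ghw] := hP w Nw; have [we _ _] := Nw.
  apply/cvgrPdist_lt => d d0.
  (* Half of the remaining room keeps [h w + r] and [h w - r] inside the interval of monotonicity.
     The strict signs of [g] at these heights persist for nearby parameters and trap the root
     between them. *)
  pose r := Num.min d ((e - `|h w|) / 2).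
  have r0 : 0 < r by rewrite lt_min d0 divr_gt0// subr_gt0.
  have rd : r <= d by rewrite ge_min lexx.
  have re : r <= (e - `|h w|) / 2 by rewrite ge_min lexx orbT.
  have pe : `|h w + r| < e.
    by apply: (le_lt_trans (ler_normD _ _)); rewrite (gtr0_norm r0); lra.
  have ne : `|h w - r| < e.
    by apply: (le_lt_trans (ler_normB _ _)); rewrite (gtr0_norm r0); lra.
  have gp : 0 < g (w, h w + r) by rewrite -ghw; apply: mono => //; lra.
  have gn : g (w, h w - r) < 0 by rewrite -ghw; apply: mono => //; lra.
  near=> x.
  have Nx : N x by near: x; exact: open_nbhs_nbhs.
  have [hxe ghx] := hP x Nx; have [xe _ _] := Nx.
  have gpx : 0 < g (x, h w + r).
    by near: x; exact: (cvgr_gt _ (cw _ _ we pe) _ gp).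
  have gnx : g (x, h w - r) < 0.
    by near: x; exact: (cvgr_lt _ (cw _ _ we ne) _ gn).
  have up : h x < h w + r.
    rewrite ltNge; apply/negP; rewrite le_eqVlt => /predU1P[E|lt].
      by move: gpx; rewrite E ghx ltxx.
    by have := mono x _ _ xe pe hxe lt; rewrite ghx ltNge ltW.
  have dn : h w - r < h x.
    rewrite ltNge; apply/negP; rewrite le_eqVlt => /predU1P[E|lt].
      by move: gnx; rewrite -E ghx ltxx.
    by have := mono x _ _ xe hxe ne lt; rewrite ghx ltNge ltW.
  by rewrite distrC ltr_norml; lra.
exists h; split.
- by rewrite -(hu 0 0 N0)// normr0.
- apply: (smooth_at_open oN) => //.
  pose U2 := U `&` [set q | 0 < 'D_vert g q].
  have oU2 : open U2.
    rewrite openE => q [Uq Dq]; apply: filterI; first exact: open_nbhs_nbhs.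
    exact: (cvgr_gt _ (CDg _ Uq) _ Dq).
  apply: (implicit_Ck (g := g) fr oN oU2) => [w Nw|q|k].
  - have [he gh] := hP w Nw; split=> //; first exact: ch.
    by apply: UD => //; case: Nw.
  - by move=> [_ Dq]; rewrite gt_eqF.
  - exact: Ck_sub (@subIsetl _ _ _) (CU k).
- by apply: filterS (open_nbhs_nbhs (conj oN N0)) => w /hP[].
- have : \forall q \near (0 : W * R), N q.1 /\ `|q.2| < e.
    apply: filterI.
      exact: (@fst_continuous _ W R 0 _ (open_nbhs_nbhs (conj oN N0))).
    have ne0 : nbhs (0 : R) [set z : R | `|z| < e].
      by apply/nbhs_normP; exists e => //= z; rewrite /= sub0r normrN.
    exact: (@snd_continuous _ W R 0 _ ne0).
  by apply: filterS => -[w z] /= [Nw ze]; exact: hu.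
Unshelve. all: by end_near. Qed.

Lemma implicit_function (g : W * R -> R) : finite_frame W ->
  smooth_on [set 0] g -> g 0 = 0 -> 'D_vert g 0 != 0 ->
  exists h : W -> R, [/\ h 0 = 0, smooth_on [set 0] h,
    \forall w \near (0 : W), g (w, h w) = 0 &
    \forall q \near (0 : W * R), g q = 0 -> q.2 = h q.1].
Proof.
move=> fr sg g0; rewrite neq_lt => /orP[D0|]; last exact: implicit_function_pos.
have dg := smooth_differentiable sg.
have [|||h [h0 sh H1 H2]] := @implicit_function_pos (fun q => - g q) fr.
- exact: smooth_opp.
- by rewrite g0 oppr0.
- by rewrite (deriveN (diff_derivable dg)) oppr_gt0.
exists h; split=> //.
  by apply: filterS H1 => w /eqP; rewrite oppr_eq0 => /eqP.
by apply: filterS H2 => q H gq; apply: H; rewrite gq oppr0.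
Qed.

End ImplicitFunction.

(** * Diffeomorphism germs *)

Section InverseGerms.
Context {R : realType}.
Implicit Types V W : normedModType R.

(** A diffeomorphism germ with its inverse named, and between possibly different spaces, so that
    changes of coordinates from rows to products can be composed with it. That [G] fixes the origin
    follows from the other clauses. *)
Definition inverse_germs V W (F : V -> W) (G : W -> V) : Prop :=
  [/\ F 0 = 0, smooth_on [set 0] F, smooth_on [set 0] G,
      \forall x \near (0 : V), G (F x) = x &
      \forall y \near (0 : W), F (G y) = y].

Lemma inverse_germs0 V W (F : V -> W) (G : W -> V) :
  inverse_germs F G -> G 0 = 0.
Proof. by move=> [F0 _ _ /nbhs_singleton]; rewrite F0. Qed.

Lemma diffeo_germP V (S : V -> V) :
  diffeo_germ S <-> exists S', inverse_germs S S'.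
Proof.
split=> [[S0 sS [S' [S'0 sS' SK KS]]]|[S' iS]]; first by exists S'.
have [S0 sS sS' SK KS] := iS; split=> //; exists S'; split=> //.
exact: inverse_germs0 iS.
Qed.

Lemma inverse_germs_sym V W (F : V -> W) (G : W -> V) :
  inverse_germs F G -> inverse_germs G F.
Proof. by move=> iF; have G0 := inverse_germs0 iF; case: iF. Qed.

Lemma near_smooth V W (f : V -> W) (p : V) (P : set W) :
  smooth_on [set p] f -> (\forall y \near f p, P y) ->
  \forall x \near p, P (f x).
Proof. by move=> /smooth_continuous cf; exact: cf. Qed.

Lemma inverse_germs_comp V W (X : normedModType R) (F : V -> W) (G : W -> V)
    (F' : W -> X) (G' : X -> W) : finite_frame W ->
  inverse_germs F G -> inverse_germs F' G' ->
  inverse_germs (fun x => F' (F x)) (fun y => G (G' y)).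
Proof.
move=> fr iF iF'; have [G0 G'0] := (inverse_germs0 iF, inverse_germs0 iF').
case: iF => F0 sF sG FK GK; case: iF' => F'0 sF' sG' F'K G'K.
split; first by rewrite F0.
- by apply: (smooth_comp fr sF); rewrite F0.
- by apply: (smooth_comp fr sG'); rewrite G'0.
- have : \forall x \near (0 : V), G' (F' (F x)) = F x.
    by apply: (near_smooth (P := fun y => G' (F' y) = y) sF); rewrite F0.
  by move=> H; near=> x; rewrite (near H x)//; near: x.
- have : \forall x \near (0 : X), F (G (G' x)) = G' x.
    by apply: (near_smooth (P := fun y => F (G y) = y) sG'); rewrite G'0.
  by move=> H; near=> x; rewrite (near H x)//; near: x.
Unshelve. all: by end_near. Qed.

Lemma inverse_germs_prod_id V W (X : normedModType R) (F : V -> W)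
    (G : W -> V) : finite_frame V -> finite_frame W -> inverse_germs F G ->
  inverse_germs (fun p : V * X => (F p.1, p.2)) (fun p : W * X => (G p.1, p.2)).
Proof.
move=> frV frW iF; have G0 := inverse_germs0 iF; case: iF => F0 sF sG FK GK.
split; first by rewrite F0.
- have sF1 := smooth_comp frV (smooth_fst (0 : V * X)) sF.
  exact: (smooth_pair sF1 (smooth_snd _)).
- have sG1 := smooth_comp frW (smooth_fst (0 : W * X)) sG.
  exact: (smooth_pair sG1 (smooth_snd _)).
- have : \forall p \near (0 : V * X), G (F p.1) = p.1.
    exact: (@fst_continuous _ V X 0 _ FK).
  by apply: filterS => -[v x] /= ->.
- have : \forall p \near (0 : W * X), F (G p.1) = p.1.
    exact: (@fst_continuous _ W X 0 _ GK).
  by apply: filterS => -[v x] /= ->.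
Qed.

(** The chain rule for [G \o F]. It is needed at all points near 0, since the axis argument takes
    place at (0, z); an identity valid near 0 is also valid near each nearby point. *)
Lemma inverse_germs_diff V W (F : V -> W) (G : W -> V) :
  inverse_germs F G ->
  \forall p \near (0 : V), forall v, 'd G (F p) ('d F p v) = v.
Proof.
move=> [F0 sF sG FK GK].
have sGF : \forall p \near (0 : V), smooth_on [set F p] G.
  apply: (near_smooth (P := fun y => smooth_on [set y] G) sF).
  by rewrite F0; exact: smooth_near.
near=> p => v.
have dF : differentiable F p.
  by apply: smooth_differentiable; near: p; exact: smooth_near.
have dG : differentiable G (F p).
  by apply: smooth_differentiable; near: p.
have : 'D_v (G \o F) p = 'D_v id p.
  by apply: near_eq_derive; near: p; exact: near_join.
rewrite derive_id (deriveE _ (differentiable_comp dF dG)).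
by rewrite (diff_comp dF dG).
Unshelve. all: by end_near. Qed.

End InverseGerms.

(** * Slices of diffeomorphism germs of a product with a line *)

Section Slices.
Context {R : realType} {W : normedModType R}.

Local Notation vert := ((0, 1) : W * R).

(* The inverse of the slice sends w to the W-component of [D' (w, h w)], where
   [h] solves [(D' (w, h w)).2 = 0]. *)
Lemma inverse_germs_slice (D D' : W * R -> W * R) : finite_frame W ->
  inverse_germs D D' -> ('D_vert D 0).1 = 0 ->
  exists K, inverse_germs (fun w => (D (w, 0)).1) K.
Proof.
move=> fr iD D1; have D'0 := inverse_germs0 iD.
have idiff := nbhs_singleton (inverse_germs_diff iD).
case: iD => D0 sD sD' DK D'K; rewrite D0 in idiff.
have frp := finite_frame_prod fr (@finite_frame_real R).
pose g q := (D' q).2.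
have sg : smooth_on [set 0] g.
  exact: (smooth_comp frp sD' (smooth_snd _)).
(* The derivative of [D] sends [vert] to a multiple [c *: vert], so that of [D'] satisfies
   [c *: 'd D' 0 vert = vert], whose second component could not be 1 if that of ['d D' 0 vert] were
   0. *)
have Dg : 'D_vert g 0 != 0.
  rewrite /g derive_linear_comp; [|exact: snd_continuous|exact: smooth_differentiable].
  have dD := smooth_differentiable sD; have dD' := smooth_differentiable sD'.
  have [c Ec] : exists c : R, 'd D 0 vert = c *: vert.
    exists ('d D 0 vert).2; rewrite -(deriveE _ dD).
    rewrite [LHS]surjective_pairing D1; apply/pair_equal_spec; split=> /=.
      by rewrite scaler0.
    by rewrite [RHS]mulr1.
  have I : 'd D' 0 (c *: vert) = vert by rewrite -Ec; exact: idiff.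
  rewrite (deriveE _ dD'); apply/eqP => E0.
  have E1 : c *: 'd D' 0 vert = vert by rewrite -linearZZ.
  have := congr1 snd E1; rewrite /= E0 => /eqP.
  by rewrite [_ *: _]mulr0 eq_sym oner_eq0.
have g0 : g 0 = 0 by rewrite /g D'0.
have [h [h0 sh H1 H2]] := implicit_function fr sg g0 Dg.
have sinl (f : W -> R) : smooth_on [set 0] f ->
    smooth_on [set 0] (fun w => (w, f w) : W * R).
  by move=> sf; exact: (smooth_pair (smooth_id 0) sf).
have sD0 : smooth_on [set 0] (fun w => D (w, 0)).
  by apply: (smooth_comp frp (sinl _ (smooth_cst 0 0))).
have sDh : smooth_on [set 0] (fun w => D' (w, h w)).
  by apply: (smooth_comp frp (sinl _ sh)); rewrite h0.
exists (fun w => (D' (w, h w)).1); split.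
- by rewrite D0.
- exact: (smooth_comp frp sD0 (smooth_fst _)).
- exact: (smooth_comp frp sDh (smooth_fst _)).
- have E1 : \forall w \near (0 : W), D' (D (w, 0)) = (w, 0).
    apply: (near_smooth (sinl _ (smooth_cst 0 0)) (P := fun q => D' (D q) = q)).
    exact: DK.
  (* The point [D (w, 0)] solves the implicit equation, because [D'] brings it back to [(w, 0)].
     Uniqueness of the solution puts it on the graph of [h]. *)
  have E2 : \forall w \near (0 : W),
      g (D (w, 0)) = 0 -> (D (w, 0)).2 = h (D (w, 0)).1.
    apply: (near_smooth sD0 (P := fun q => g q = 0 -> q.2 = h q.1)).
    by rewrite D0.
  near=> w; rewrite -(near E2 w)//.
    by rewrite -surjective_pairing (near E1 w).
  by rewrite /g (near E1 w).
- have E1 : \forall w \near (0 : W), D (D' (w, h w)) = (w, h w).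
    apply: (near_smooth (sinl _ sh) (P := fun q => D (D' q) = q)).
    by rewrite h0.
  near=> w.
  have -> : ((D' (w, h w)).1, 0) = D' (w, h w).
    by rewrite -(near H1 w)// -surjective_pairing.
  by rewrite (near E1 w).
Unshelve. all: by end_near. Qed.

Lemma slice_derive_eq0 (D : W * R -> W * R) :
  differentiable D 0 -> (\forall z \near (0 : R), (D (0, z)).1 = 0) ->
  ('D_vert D 0).1 = 0.
Proof.
move=> dD Dz; rewrite -(derive_linear_comp _ (@fst_continuous _ W R) dD).
have df : differentiable (fun q => (D q).1) ((0, 0) : W * R).
  apply: (differentiable_comp dD); apply: linear_differentiable.
  exact: fst_continuous.
have [_ <-] := is_derive_slice df.
rewrite (near_eq_derive (g := cst 0)); first exact: derive_cst.
exact: Dz.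
Qed.

End Slices.

(** * Cancelling the line factor from an equivalence *)

Section Desuspension.
Context {R : realType} {W : normedModType R}.

(** At [(t, 0)] the first component of the relation already reads [c (S t) = T (gam t)] for the
    projected slices. All the work goes into showing that these slices are invertible. *)
Lemma germ_equiv_of_product_equiv (c gam : R -> W) (D D' : R * R -> R * R)
    (E E' : W * R -> W * R) : finite_frame W ->
  inverse_germs D D' -> inverse_germs E E' ->
  (forall u, differentiable c u) -> c 0 = 0 ->
  (forall u, 'D_1 c u = 0 -> u = 0) ->
  smooth_on [set 0] gam -> gam 0 = 0 -> 'd gam 0 1 = 0 ->
  (\forall q \near (0 : R * R), (c (D q).1, (D q).2) = E (gam q.1, q.2)) ->
  exists S S' T T', [/\ inverse_germs S S', inverse_germs T T' &
    \forall t \near (0 : R), c (S t) = T (gam t)].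
Proof.
move=> fr iD iE dc c0 dc0 sgam gam0 dgam rel.
have [D0 sD sD' DK D'K] := iD; have [E0 sE _ _ _] := iE.
have inrR (P : set (R * R)) : (\forall q \near (0 : R * R), P q) ->
    \forall z \near (0 : R), P (0, z).
  move=> HP; have := is_diff_inr (0 : R) 0 => di.
  exact: (differentiable_continuous (ex_diff (is_diff_def := di)) HP).
have inrW (P : set (W * R)) : (\forall q \near (0 : W * R), P q) ->
    \forall z \near (0 : R), P (0, z).
  move=> HP; have := is_diff_inr (0 : W) 0 => di.
  exact: (differentiable_continuous (ex_diff (is_diff_def := di)) HP).
have inlR (P : set (R * R)) : (\forall q \near (0 : R * R), P q) ->
    \forall z \near (0 : R), P (z, 0).
  move=> HP; have := is_diff_inl (0 : R) 0 => di.
  exact: (differentiable_continuous (ex_diff (is_diff_def := di)) HP).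
(* Both sides of the relation are differentiated at [(0, z)] along [(1, 0)]; the right side gives 0
   because ['d gam 0 1 = 0]. *)
have Dax : \forall z \near (0 : R), (D (0, z)).1 = 0.
  have H1 := inrR _ (near_join rel).
  have H2 := inrR _ (smooth_near sD).
  have H3 := inrW _ (smooth_near sE).
  have H4 := inrR _ (inverse_germs_diff iD).
  near=> z.
  have dD : differentiable D (0, z).
    by apply: smooth_differentiable; near: z.
  have dE : differentiable E (gam 0, z).
    by rewrite gam0; apply: smooth_differentiable; near: z.
  pose G (q : R * R) : W * R := (gam q.1, q.2).
  have dg : is_diff ((0, z) : R * R) G
      (fun v => ('d gam 0 v.1, v.2)).
    have df1 := is_diff_linear (L := fst) ((0, z) : R * R) (@fst_continuous _ R R).
    have df2 := is_diff_linear (L := snd) ((0, z) : R * R) (@snd_continuous _ R R).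
    have dg0 := differentiableP (smooth_differentiable sgam).
    exact: is_diff_pair.
  pose u := (D (0, z)).1.
  have dL : is_diff ((0, z) : R * R) (fun q => (c (D q).1, (D q).2))
      (fun v => ('d c u ('d D (0, z) v).1, ('d D (0, z) v).2)).
    have df1 := is_diff_linear (L := fst) (D (0, z)) (@fst_continuous _ R R).
    have df2 := is_diff_linear (L := snd) (D (0, z)) (@snd_continuous _ R R).
    have dD1 := differentiableP dD.
    have dc1 := differentiableP (dc u).
    have dD2 := is_diff_comp dD1 df1.
    exact: (is_diff_pair (is_diff_comp dD2 dc1) (is_diff_comp dD1 df2)).
  have EqD : 'D_(1, 0) (fun q => (c (D q).1, (D q).2)) ((0, z) : R * R) =
      'D_(1, 0) (E \o G) ((0, z) : R * R).
    by apply: near_eq_derive; near: z.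
  have dg1 := ex_diff (is_diff_def := dg).
  have Gd : 'd G ((0, z) : R * R) (1, 0) = 0.
    rewrite (diff_val (is_diff_def := dg)).
    by apply/pair_equal_spec; split; [exact: dgam|].
  have Rd : 'D_(1, 0) (E \o G) ((0, z) : R * R) = 0.
    rewrite (deriveE _ (differentiable_comp dg1 dE)) (diff_comp dg1 dE).
    apply: (etrans (congr1 ('d E (gam 0, z)) Gd)); exact: linear0.
  move: EqD; rewrite Rd (deriveE _ (ex_diff (is_diff_def := dL))) diff_val.
  move=> /pair_equal_spec[/= Ec Es].
  have inj : forall v, 'd D' (D (0, z)) ('d D ((0, z) : R * R) v) = v.
    by near: z; exact: H4.
  apply: dc0; rewrite (deriveE _ (dc _)).
  (* The second component of this vector vanishes by [Es]; were the first to vanish too, the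
     derivative of [D] would kill [(1, 0)] although it has a left inverse. *)
  have A0 : ('d D (0, z) (1, 0)).1 != 0.
    apply/eqP => A0; have AE0 : 'd D ((0, z) : R * R) (1, 0) = 0.
      by rewrite [LHS]surjective_pairing A0 Es.
    have I0 := etrans (congr1 ('d D' (D (0, z))) (esym AE0)) (inj (1, 0)).
    have L0 : 'd D' (D (0, z)) 0 = 0 by exact: linear0.
    by have /eqP := congr1 fst (etrans (esym L0) I0); rewrite eq_sym oner_eq0.
  move: Ec; rewrite -[X in 'd c _ X = _]mulr1 linearZZ => /eqP.
  by rewrite scaler_eq0 (negbTE A0) => /eqP.
have Eax : \forall z \near (0 : R), (E (0, z)).1 = 0.
  have H1 := inrR _ rel.
  near=> z; rewrite -{1}gam0 -(near H1 z)//= (near Dax z)//.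
have [S' iS] := inverse_germs_slice (@finite_frame_real R) iD
  (slice_derive_eq0 (smooth_differentiable sD) Dax).
have [T' iT] := inverse_germs_slice fr iE
  (slice_derive_eq0 (smooth_differentiable sE) Eax).
exists (fun t => (D (t, 0)).1), S', (fun w => (E (w, 0)).1), T'; split=> //.
by apply: filterS (inlR _ rel) => t /= <-.
Unshelve. all: by end_near. Qed.

End Desuspension.

(** * Cylindrical coordinates *)

Section Cylindrical.
Context {R : realType}.
Implicit Types V : normedModType R.

Local Notation R2 := 'rV[R]_2.
Local Notation R3 := 'rV[R]_3.

Definition ord1_3 : 'I_3 := lift ord0 ord0.

Lemma vec2E (a b : R) : (vec2 a b ord0 ord0 = a) * (vec2 a b ord0 ord_max = b).
Proof. by split; rewrite mxE. Qed.

Lemma vec3E (a b c : R) : (vec3 a b c ord0 ord0 = a) *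
  (vec3 a b c ord0 ord1_3 = b) * (vec3 a b c ord0 ord_max = c).
Proof. by do !split; rewrite mxE. Qed.

Lemma row2P (u v : R2) : u ord0 ord0 = v ord0 ord0 ->
  u ord0 ord_max = v ord0 ord_max -> u = v.
Proof.
move=> E0 E1; apply/rowP => -[[|[|//]] hi].
  by rewrite (_ : Ordinal hi = ord0)//; exact/val_inj.
by rewrite (_ : Ordinal hi = ord_max)//; exact/val_inj.
Qed.

Lemma row3P (u v : R3) : u ord0 ord0 = v ord0 ord0 ->
  u ord0 ord1_3 = v ord0 ord1_3 -> u ord0 ord_max = v ord0 ord_max -> u = v.
Proof.
move=> E0 E1 E2; apply/rowP => -[[|[|[|//]]] hi].
- by rewrite (_ : Ordinal hi = ord0)//; exact/val_inj.
- by rewrite (_ : Ordinal hi = ord1_3)//; exact/val_inj.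
- by rewrite (_ : Ordinal hi = ord_max)//; exact/val_inj.
Qed.

Lemma vec2_0 : vec2 0 0 = 0 :> R2.
Proof. by apply: row2P; rewrite vec2E mxE. Qed.

Lemma vec3_0 : vec3 0 0 0 = 0 :> R3.
Proof. by apply: row3P; rewrite vec3E mxE. Qed.

Lemma vec2_eta (w : R2) : vec2 (w ord0 ord0) (w ord0 ord_max) = w.
Proof. by apply: row2P; rewrite vec2E. Qed.

Lemma vec3_eta (w : R3) :
  vec3 (w ord0 ord0) (w ord0 ord1_3) (w ord0 ord_max) = w.
Proof. by apply: row3P; rewrite vec3E. Qed.

Lemma smooth_vec2 V (a b : V -> R) (p : V) : smooth_on [set p] a ->
  smooth_on [set p] b -> smooth_on [set p] (fun x => vec2 (a x) (b x)).
Proof.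
move=> sa sb.
have -> : (fun x => vec2 (a x) (b x)) =
    fun x => a x *: (vec2 1 0 : R2) + b x *: (vec2 0 1 : R2).
  by apply/funext => x; apply: row2P;
    rewrite ![in RHS]mxE /= vec2E ?mulr0 ?mulr1 ?addr0 ?add0r.
exact: (smooth_add (smooth_scale sa (smooth_cst _ _))
  (smooth_scale sb (smooth_cst _ _))).
Qed.

Lemma smooth_vec3 V (a b c : V -> R) (p : V) : smooth_on [set p] a ->
  smooth_on [set p] b -> smooth_on [set p] c ->
  smooth_on [set p] (fun x => vec3 (a x) (b x) (c x)).
Proof.
move=> sa sb sc.
have -> : (fun x => vec3 (a x) (b x) (c x)) = fun x => a x *: (vec3 1 0 0 : R3)
    + b x *: (vec3 0 1 0 : R3) + c x *: (vec3 0 0 1 : R3).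
  by apply/funext => x; apply: row3P;
    rewrite ![in RHS]mxE /= vec3E ?mulr0 ?mulr1 ?addr0 ?add0r.
exact: (smooth_add (smooth_add (smooth_scale sa (smooth_cst _ _))
  (smooth_scale sb (smooth_cst _ _))) (smooth_scale sc (smooth_cst _ _))).
Qed.

Lemma smooth_coord V n (f : V -> 'rV[R]_n) (i : 'I_n) (p : V) :
  smooth_on [set p] f -> smooth_on [set p] (fun x => f x ord0 i).
Proof.
move=> sf.
have sc : smooth_on [set f p] (fun w : 'rV[R]_n => w ord0 i).
  exact: (smooth_linear (L := row_coord i) (f p) (@row_coord_continuous R n i)).
exact: (smooth_comp (@finite_frame_row R n) sf sc).
Qed.

(** Rows are exchanged for products so that the last coordinate is split off as the line factor of
    the slice argument. *)
Definition pair_of_row2 (w : R2) : R * R := (w ord0 ord0, w ord0 ord_max).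

Definition row2_of_pair (q : R * R) : R2 := vec2 q.1 q.2.

Definition pair_of_row3 (w : R3) : R2 * R :=
  (vec2 (w ord0 ord0) (w ord0 ord1_3), w ord0 ord_max).

Definition row3_of_pair (q : R2 * R) : R3 :=
  vec3 (q.1 ord0 ord0) (q.1 ord0 ord_max) q.2.

Lemma inverse_germs_row2 : inverse_germs row2_of_pair pair_of_row2.
Proof.
split; first exact: vec2_0.
- exact: (smooth_vec2 (smooth_fst _) (smooth_snd _)).
- exact: (smooth_pair (smooth_coord _ (smooth_id _)) (smooth_coord _ (smooth_id _))).
- by apply: filterE => -[a b]; rewrite /pair_of_row2 !vec2E.
- by apply: filterE => w; exact: vec2_eta.
Qed.

Lemma inverse_germs_row3 : inverse_germs row3_of_pair pair_of_row3.
Proof.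
split; first by rewrite /row3_of_pair !mxE vec3_0.
- exact: (smooth_vec3 (smooth_coord _ (smooth_fst _))
    (smooth_coord _ (smooth_fst _)) (smooth_snd _)).
- exact: (smooth_pair (smooth_vec2 (smooth_coord _ (smooth_id _))
    (smooth_coord _ (smooth_id _))) (smooth_coord _ (smooth_id _))).
- by apply: filterE => -[a b]; rewrite /pair_of_row3 !vec3E vec2_eta.
- by apply: filterE => w; rewrite /row3_of_pair !vec2E vec3_eta.
Qed.

Context (r0 theta : R) (r0_gt0 : 0 < r0).

(* [cylinder] sends ((x, r - r0), phi) to (x, r cos (theta + phi),
   r sin (theta + phi)), recentred at the origin.  In the frame rotated by
   [- theta] the last two coordinates become [axial] and [lateral], that is
   (r cos phi, r sin phi), so that phi = atan (lateral / axial) and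
   r = axial / cos phi, with no square root. *)
Definition cylinder (q : R2 * R) : R3 :=
  vec3 (q.1 ord0 ord0)
    ((r0 + q.1 ord0 ord_max) * cos (theta + q.2) - r0 * cos theta)
    ((r0 + q.1 ord0 ord_max) * sin (theta + q.2) - r0 * sin theta).

Definition axial (v : R3) : R :=
  cos theta * (v ord0 ord1_3 + r0 * cos theta) +
  sin theta * (v ord0 ord_max + r0 * sin theta).

Definition lateral (v : R3) : R :=
  cos theta * (v ord0 ord_max + r0 * sin theta) -
  sin theta * (v ord0 ord1_3 + r0 * cos theta).

Definition cylinder_angle (v : R3) : R := atan (lateral v / axial v).

Definition cylinder_inv (v : R3) : R2 * R :=
  (vec2 (v ord0 ord0) (axial v / cos (cylinder_angle v) - r0),
   cylinder_angle v).

Lemma cos_atan_gt0 (z : R) : 0 < cos (atan z).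
Proof. by apply: cos_gt0_pihalf; rewrite atan_gtNpi2 atan_ltpi2. Qed.

Lemma axial0 : axial 0 = r0.
Proof.
rewrite /axial !mxE !add0r.
transitivity (r0 * (cos theta ^+ 2 + sin theta ^+ 2)); first ring.
by rewrite cos2Dsin2 mulr1.
Qed.

Lemma smooth_axial (v : R3) : smooth_on [set v] axial.
Proof.
exact: (smooth_add (smooth_mul (smooth_cst _ _)
    (smooth_add (smooth_coord _ (smooth_id _)) (smooth_cst _ _)))
  (smooth_mul (smooth_cst _ _)
    (smooth_add (smooth_coord _ (smooth_id _)) (smooth_cst _ _)))).
Qed.

Lemma smooth_lateral (v : R3) : smooth_on [set v] lateral.
Proof.
exact: (smooth_add (smooth_mul (smooth_cst _ _)
    (smooth_add (smooth_coord _ (smooth_id _)) (smooth_cst _ _)))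
  (smooth_opp (smooth_mul (smooth_cst _ _)
    (smooth_add (smooth_coord _ (smooth_id _)) (smooth_cst _ _))))).
Qed.

Lemma smooth_cylinder (q : R2 * R) : smooth_on [set q] cylinder.
Proof.
have sr : smooth_on [set q] (fun q : R2 * R => r0 + q.1 ord0 ord_max).
  exact: (smooth_add (smooth_cst _ _) (smooth_coord _ (smooth_fst _))).
have st : smooth_on [set q] (fun q : R2 * R => theta + q.2).
  exact: (smooth_add (smooth_cst _ _) (smooth_snd _)).
have frR := @finite_frame_real R.
exact: (smooth_vec3 (smooth_coord _ (smooth_fst _))
  (smooth_add (smooth_mul sr (smooth_comp frR st (smooth_cos _))) (smooth_cst _ _))
  (smooth_add (smooth_mul sr (smooth_comp frR st (smooth_sin _))) (smooth_cst _ _))).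
Qed.

Lemma smooth_cylinder_inv : smooth_on [set 0] cylinder_inv.
Proof.
have frR := @finite_frame_real R.
have sA := smooth_axial 0.
have sq : smooth_on [set 0] (fun v => lateral v / axial v).
  apply: (smooth_mul (smooth_lateral 0) (smooth_inv sA _)).
  by rewrite axial0 gt_eqF.
have sa : smooth_on [set 0] cylinder_angle := smooth_comp frR sq (smooth_atan _).
have sca := smooth_comp frR sa (smooth_cos _).
have sr : smooth_on [set 0] (fun v => axial v / cos (cylinder_angle v) - r0).
  apply: (smooth_add (smooth_mul sA (smooth_inv sca _)) (smooth_cst _ _)).
  by rewrite gt_eqF// cos_atan_gt0.
exact: (smooth_pair (smooth_vec2 (smooth_coord _ (smooth_id _)) sr) sa).
Qed.

(** With positive radius the quotient of [lateral] by [axial] is the tangent of the angle, and the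
    bounds on [q.2] select the branch inverted by [atan]. *)
Lemma cylinderK (q : R2 * R) : 0 < r0 + q.1 ord0 ord_max ->
  - (pi / 2) < q.2 < pi / 2 -> cylinder_inv (cylinder q) = q.
Proof.
case: q => w phi /= r_gt0 hphi; set r := r0 + _ in r_gt0.
have cphi : cos phi != 0 by rewrite gt_eqF// cos_gt0_pihalf.
have cs := cos2Dsin2 theta.
have EA : axial (cylinder (w, phi)) = r * cos phi.
  rewrite /axial !vec3E /= !subrK -/r cosD sinD.
  transitivity (r * cos phi * (cos theta ^+ 2 + sin theta ^+ 2)); first ring.
  by rewrite cs mulr1.
have EB : lateral (cylinder (w, phi)) = r * sin phi.
  rewrite /lateral !vec3E /= !subrK -/r cosD sinD.
  transitivity (r * sin phi * (cos theta ^+ 2 + sin theta ^+ 2)); first ring.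
  by rewrite cs mulr1.
have Et : cylinder_angle (cylinder (w, phi)) = phi.
  rewrite /cylinder_angle EA EB -mulf_div divff ?gt_eqF// mul1r.
  by rewrite -[sin phi / cos phi]/(tan phi) tanK// in_itv/=.
rewrite /cylinder_inv Et EA mulfK// /r addrC addKr vec3E /=.
by rewrite vec2_eta.
Qed.

(** The polar coordinates found satisfy [r * cos t = axial v] and [r * sin t = lateral v]; rotating
    back by [theta] recovers the two coordinates of [v]. *)
Lemma cylinder_invK (v : R3) : 0 < axial v -> cylinder (cylinder_inv v) = v.
Proof.
move=> A_gt0; set t := cylinder_angle v.
have ct : cos t != 0 by rewrite gt_eqF// cos_atan_gt0.
have cs := cos2Dsin2 theta.
pose r := axial v / cos t.
have EA : r * cos t = axial v by rewrite /r mulfVK.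
have EB : r * sin t = lateral v.
  have Et : sin t / cos t = lateral v / axial v by exact: atanK.
  have -> : r * sin t = axial v * (sin t / cos t).
    by rewrite /r mulrAC mulrA.
  by rewrite Et mulrCA divff ?mulr1 ?gt_eqF.
have Er : r0 + (r - r0) = r by ring.
rewrite /cylinder /cylinder_inv /= -/t !vec2E -/r Er cosD sinD.
apply: row3P; rewrite vec3E //.
  transitivity (cos theta * (r * cos t) - sin theta * (r * sin t) - r0 * cos theta).
    by ring.
  rewrite EA EB /axial /lateral.
  transitivity ((v ord0 ord1_3 + r0 * cos theta) *
    (cos theta ^+ 2 + sin theta ^+ 2) - r0 * cos theta); first ring.
  by rewrite cs mulr1 addrK.
transitivity (sin theta * (r * cos t) + cos theta * (r * sin t) - r0 * sin theta).
  by ring.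
rewrite EA EB /axial /lateral.
transitivity ((v ord0 ord_max + r0 * sin theta) *
  (cos theta ^+ 2 + sin theta ^+ 2) - r0 * sin theta); first ring.
by rewrite cs mulr1 addrK.
Qed.

Lemma inverse_germs_cylinder : inverse_germs cylinder cylinder_inv.
Proof.
split.
- by rewrite /cylinder /= !mxE !addr0 !subrr vec3_0.
- exact: smooth_cylinder.
- exact: smooth_cylinder_inv.
- have H1 : nbhs (0 : R2 * R) [set q : R2 * R | 0 < r0 + q.1 ord0 ord_max].
    have s1 := smooth_continuous (smooth_add (smooth_cst r0 _)
      (smooth_coord ord_max (smooth_fst (0 : R2 * R)))).
    by apply: (cvgr_gt _ s1); rewrite /= mxE addr0.
  have H2 : \forall q \near (0 : R2 * R), - (pi / 2) < q.2 < pi / 2.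
    have s1 := smooth_continuous (smooth_snd (0 : R2 * R)).
    have p2 : 0 < pi / 2 :> R by rewrite divr_gt0// pi_gt0.
    near=> q; apply/andP; split; near: q.
      by apply: (cvgr_gt _ s1); rewrite /= oppr_lt0.
    by apply: (cvgr_lt _ s1).
  by near=> q; apply: cylinderK; near: q.
- have H : \forall v \near (0 : R3), 0 < axial v.
    by apply: (cvgr_gt _ (smooth_continuous (smooth_axial 0))); rewrite axial0.
  by apply: filterS H => v; exact: cylinder_invK.
Unshelve. all: by end_near. Qed.

End Cylindrical.

(** * Surfaces of revolution *)

Section Revolution.
Context {R : realType}.

Lemma is_diff_germ_at (V W : normedModType R) (f : V -> W) (p : V) :
  differentiable f p -> is_diff 0 (germ_at f p) ('d f p).
Proof.
move=> df; apply: is_diff_eps; first exact: diff_continuous.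
move=> e e0; apply: filterS (diff_eps df e0) => h.
by rewrite /germ_at !addr0 subrr subr0 [p + h]addrC.
Qed.

Lemma smooth_germ_at (V W : normedModType R) (f : V -> W) (p : V) :
  finite_frame V -> smooth_on [set p] f -> smooth_on [set 0] (germ_at f p).
Proof.
move=> fr sf; have st : smooth_on [set 0] (fun x : V => p + x).
  exact: (smooth_add (smooth_cst _ _) (smooth_id _)).
apply: (smooth_add (smooth_comp fr st _) (smooth_cst _ _)).
by rewrite addr0.
Qed.

Lemma A_equivalentP (V W : normedModType R) (f1 f2 : V -> W) :
  A_equivalent f1 f2 <-> exists S S' T T',
    [/\ inverse_germs S S', inverse_germs T T' &
        \forall x \near (0 : V), f2 (S x) = T (f1 x)].
Proof.
split=> [[S [T [/diffeo_germP[S' iS] /diffeo_germP[T' iT] H]]]|].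
  by exists S, S', T, T'.
move=> [S [S' [T [T' [iS iT H]]]]]; exists S, T; split=> //; apply/diffeo_germP.
  by exists S'.
by exists T'.
Qed.

Lemma smooth_exp n (p : R) : smooth_on [set p] (fun u : R => u ^+ n).
Proof.
elim: n => [|n IH]; first exact: smooth_cst.
under eq_fun do rewrite exprS.
exact: (smooth_mul (smooth_id _) IH).
Qed.

(** The first coordinate suffices: its derivative is a nonzero integer times a positive power of
    [u]. *)
Lemma derive_vec2_exp_eq0 (i j : nat) (u : R) : (1 < i)%N ->
  'D_1 (fun u : R => vec2 (u ^+ i) (u ^+ j)) u = 0 -> u = 0.
Proof.
case: i => [|[|i]]// _ D0.
have dc := smooth_differentiable (smooth_vec2 (smooth_exp i.+2 u) (smooth_exp j u)).
have := derive_linear_comp (L := row_coord ord0) (1 : R)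
  (@row_coord_continuous R 2 ord0) dc.
rewrite D0 linear0 /=.
have -> : (fun u : R => row_coord ord0 (vec2 (u ^+ i.+2) (u ^+ j))) =
    (fun u => u ^+ i.+2).
  by apply/funext => v; rewrite /row_coord vec2E.
rewrite exp_derive => /eqP; rewrite [_ *: 1]mulr1 scaler_eq0 /= => /orP[/eqP/esym|].
  by move=> /eqP; rewrite -[0]/(0%:R) eqr_nat.
by rewrite expf_eq0 /= => /eqP.
Qed.

Context (x y : R -> R) (p theta : R).

Local Notation gam := (plane_curve x y).
Local Notation surf := (surface_of_revolution x y).
Local Notation q0 := (vec2 p theta).

(** With [y p] as reference radius and [theta] as reference angle, the recentring of [cylinder]
    matches that of both germs, so the factorisation holds for every [w] and not only near 0. *)
Lemma germ_at_revolution (w : 'rV[R]_2) : germ_at surf q0 w =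
  cylinder (y p) theta (germ_at gam p (w ord0 ord0), w ord0 ord_max).
Proof.
rewrite /germ_at /surface_of_revolution /cylinder /plane_curve !mxE /=.
apply: row3P; rewrite !mxE //=.
  by rewrite subrKC.
by rewrite subrKC.
Qed.

Context (sgam : smooth_on [set p] gam) (yp_gt0 : 0 < y p).

Lemma smooth_revolution : smooth_on [set q0] surf.
Proof.
have frR := @finite_frame_real R.
have sx : smooth_on [set p] x.
  by apply: smooth_ext (smooth_coord ord0 sgam); apply: filterE => t; rewrite vec2E.
have sy : smooth_on [set p] y.
  by apply: smooth_ext (smooth_coord ord_max sgam); apply: filterE => t; rewrite vec2E.
have st : smooth_on [set q0] (fun w : 'rV[R]_2 => w ord0 ord0).
  exact: smooth_coord (smooth_id _).
have sth : smooth_on [set q0] (fun w : 'rV[R]_2 => w ord0 ord_max).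
  exact: smooth_coord (smooth_id _).
have sxt : smooth_on [set q0] (fun w : 'rV[R]_2 => x (w ord0 ord0)).
  by apply: (smooth_comp frR st); rewrite vec2E.
have syt : smooth_on [set q0] (fun w : 'rV[R]_2 => y (w ord0 ord0)).
  by apply: (smooth_comp frR st); rewrite vec2E.
exact: (smooth_vec3 sxt (smooth_mul syt (smooth_comp frR sth (smooth_cos _)))
  (smooth_mul syt (smooth_comp frR sth (smooth_sin _)))).
Qed.

Lemma diff_revolution (w : 'rV[R]_2) : 'd surf q0 w =
  'd (cylinder (y p) theta) 0 ('d gam p (w ord0 ord0), w ord0 ord_max).
Proof.
have dg := is_diff_germ_at (smooth_differentiable sgam).
pose K (w : 'rV[R]_2) := (germ_at gam p (w ord0 ord0), w ord0 ord_max).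
have dK : is_diff 0 K (fun w => ('d gam p (w ord0 ord0), w ord0 ord_max)).
  have d0 := is_diff_linear (L := row_coord ord0) (0 : 'rV[R]_2)
    (@row_coord_continuous R 2 ord0).
  have d1 := is_diff_linear (L := row_coord ord_max) (0 : 'rV[R]_2)
    (@row_coord_continuous R 2 ord_max).
  have dg0 : is_diff (row_coord ord0 (0 : 'rV[R]_2)) (germ_at gam p) ('d gam p).
    by rewrite [row_coord _ _]mxE.
  exact: (is_diff_pair (is_diff_comp d0 dg0) d1).
have K0 : K 0 = 0 by rewrite /K !mxE /germ_at addr0 subrr.
have dcyl : differentiable (cylinder (y p) theta) (K 0).
  exact/smooth_differentiable/smooth_cylinder.
have ds := is_diff_germ_at (smooth_differentiable smooth_revolution).
have E : germ_at surf q0 = cylinder (y p) theta \o K.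
  by apply/funext => v; exact: germ_at_revolution.
rewrite -(diff_val (is_diff_def := ds)) E.
rewrite (diff_comp (ex_diff (is_diff_def := dK)) dcyl) K0.
by rewrite /= (diff_val (is_diff_def := dK)).
Qed.

Lemma singular_curveE : singular_point gam p <-> 'd gam p 1 = 0.
Proof.
have dE t : 'd gam p t = t *: 'd gam p 1.
  by rewrite -[t in LHS]mulr1; exact: linearZZ.
split=> [sing|d0 inj].
  apply/eqP/negP => /negP d0; apply: sing => s t; rewrite dE [in RHS]dE => /eqP.
  by rewrite -subr_eq0 -scalerBl scaler_eq0 (negbTE d0) orbF subr_eq0 => /eqP.
have := inj 1 0; rewrite d0 linear0 => /(_ erefl)/eqP.
by rewrite oner_eq0.
Qed.

(** The derivative of [cylinder] at 0 has a left inverse and the angle enters by the identity, so a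
    kernel can only come from the profile curve. *)
Lemma singular_revolutionE : singular_point surf q0 <-> 'd gam p 1 = 0.
Proof.
have icyl := inverse_germs_cylinder theta yp_gt0.
have := nbhs_singleton (inverse_germs_diff icyl).
have [-> _ _ _ _] := icyl => cylI.
split=> [sing|d0 inj].
  apply: contrapT => d0; apply: sing => v w; rewrite !diff_revolution.
  move=> /(congr1 ('d (cylinder_inv (y p) theta) 0)); rewrite !cylI.
  move=> /pair_equal_spec[E0 E1]; apply: row2P => //.
  have : ~ singular_point gam p by rewrite singular_curveE.
  by rewrite /singular_point => /contrapT inj; exact: inj.
have : vec2 1 0 = vec2 0 0 :> 'rV[R]_2.
  have L0 : 'd gam p 0 = 0 by exact: linear0.
  by apply: inj; rewrite !diff_revolution !vec2E d0 L0.
by move=> /rowP/(_ ord0)/eqP; rewrite !vec2E oner_eq0.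
Qed.

Lemma A_equivalent_revolution (i j : nat) : (1 < i)%N -> (0 < j)%N ->
  'd gam p 1 = 0 ->
  A_equivalent (germ_at surf q0)
    (fun w : 'rV[R]_2 => vec3 (w ord0 ord0 ^+ i) (w ord0 ord0 ^+ j)
                              (w ord0 ord_max)) <->
  A_equivalent (germ_at gam p) (fun t : R => vec2 (t ^+ i) (t ^+ j)).
Proof.
move=> i1 j0 dgam; rewrite !A_equivalentP.
have frR := @finite_frame_real R.
have fr2 := @finite_frame_row R 2; have fr3 := @finite_frame_row R 3.
have frRR := finite_frame_prod frR frR; have fr2R := finite_frame_prod fr2 frR.
have i2 := @inverse_germs_row2 R; have i3 := @inverse_germs_row3 R.
have icyl := inverse_germs_cylinder theta yp_gt0.
have sg0 := smooth_germ_at frR sgam.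
have g00 : germ_at gam p 0 = 0 by rewrite /germ_at addr0 subrr.
pose c (u : R) := vec2 (u ^+ i) (u ^+ j).
split=> [[S [S' [T [T' [iS iT H]]]]]|[S [S' [T [T' [iS iT H]]]]]].
  (* The source change is conjugated from rows to pairs. In the target, [cylinder] is composed
     before [T], which turns the surface into the product of the curve with the angle. *)
  have iD := inverse_germs_comp fr2 (inverse_germs_comp fr2 i2 iS)
    (inverse_germs_sym i2).
  have iE := inverse_germs_comp fr3 (inverse_germs_comp fr3 icyl iT)
    (inverse_germs_sym i3).
  have dc u : differentiable c u.
    exact/smooth_differentiable/(smooth_vec2 (smooth_exp _ _) (smooth_exp _ _)).
  have c0 : c 0 = 0 by rewrite /c !expr0n !gtn_eqF ?vec2_0// ltnW.
  have cz u : 'D_1 c u = 0 -> u = 0 by exact: derive_vec2_exp_eq0.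
  have dg : 'd (germ_at gam p) 0 1 = 0.
    have dg := is_diff_germ_at (smooth_differentiable sgam).
    by rewrite (diff_val (is_diff_def := dg)).
  have [_ s2 _ _ _] := i2.
  have H2 : \forall q \near (0 : R * R),
      vec3 (S (row2_of_pair q) ord0 ord0 ^+ i) (S (row2_of_pair q) ord0 ord0 ^+ j)
        (S (row2_of_pair q) ord0 ord_max) = T (germ_at surf q0 (row2_of_pair q)).
    apply: (near_smooth (P := fun w => vec3 (S w ord0 ord0 ^+ i)
      (S w ord0 ord0 ^+ j) (S w ord0 ord_max) = T (germ_at surf q0 w)) s2).
    by rewrite [row2_of_pair 0]vec2_0.
  have rel : \forall q \near (0 : R * R),
      (c (pair_of_row2 (S (row2_of_pair q))).1,
       (pair_of_row2 (S (row2_of_pair q))).2) =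
      pair_of_row3 (T (cylinder (y p) theta (germ_at gam p q.1, q.2))).
    apply: filterS H2 => q; rewrite germ_at_revolution !vec2E => <-.
    by rewrite /pair_of_row3 !vec3E.
  exact: (germ_equiv_of_product_equiv fr2 iD iE dc c0 cz sg0 g00 dg rel).
(* Conversely, both changes are extended by the identity on the angle, and [cylinder_inv] first
   straightens the surface into a product. *)
have iS2 := inverse_germs_comp frRR (inverse_germs_comp frRR
  (inverse_germs_sym i2) (inverse_germs_prod_id R frR frR iS)) i2.
have iT2 := inverse_germs_comp fr2R (inverse_germs_comp fr2R
  (inverse_germs_sym icyl) (inverse_germs_prod_id R fr2 fr2 iT)) i3.
do 4 eexists; split; [exact: iS2|exact: iT2|].
have s0 := smooth_coord ord0 (smooth_id (0 : 'rV[R]_2)).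
have s1 := smooth_coord ord_max (smooth_id (0 : 'rV[R]_2)).
have H1 : nbhs (0 : 'rV[R]_2) [set w : 'rV[R]_2 |
    c (S (w ord0 ord0)) = T (germ_at gam p (w ord0 ord0))].
  apply: (near_smooth (P := fun t => c (S t) = T (germ_at gam p t)) s0).
  by rewrite mxE.
pose K (w : 'rV[R]_2) := (germ_at gam p (w ord0 ord0), w ord0 ord_max).
have sK : smooth_on [set 0] K.
  by apply: (smooth_pair (smooth_comp frR s0 _) s1); rewrite mxE.
have H2 : \forall w \near (0 : 'rV[R]_2),
    cylinder_inv (y p) theta (cylinder (y p) theta (K w)) = K w.
  apply: (near_smooth (P := fun q => cylinder_inv (y p) theta
    (cylinder (y p) theta q) = q) sK).
  have -> : K 0 = 0 by rewrite /K !mxE g00.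
  by case: icyl.
near=> w; rewrite germ_at_revolution -/(K w) (near H2 w)//= -(near H1 w)//.
by rewrite /row3_of_pair /= !vec2E.
Unshelve. all: by end_near. Qed.

End Revolution.

Theorem mainTheorem4 (R : realType) (I : set R) (x y : R -> R) (i j : nat)
    (p theta : R)
    (hI : is_interval I)
    (hgamma : smooth_on I (plane_curve x y))
    (hy : forall t : R, I t -> 0 < y t)
    (hij : (i, j) \in [:: (2, 3); (2, 5); (3, 4); (3, 5)]%N)
    (hp : I p) :
  is_cuspidal_edge j i (surface_of_revolution x y) (vec2 p theta) <->
  is_cusp j i (plane_curve x y) p.
Proof.
have [i1 j0] : (1 < i)%N /\ (0 < j)%N.
  by move: hij; rewrite !inE => /or4P[] /eqP[-> ->].
have sgam := smooth_onP hp hgamma; have yp := hy p hp.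
(* Both singularity clauses become the vanishing of the velocity of the profile at [p], which is
   then the hypothesis under which the germs are compared. *)
rewrite /is_cuspidal_edge /is_cusp (singular_revolutionE theta sgam yp).
rewrite singular_curveE; split=> -[d0 H]; split=> //.
  exact: (A_equivalent_revolution theta sgam yp i1 j0 d0).1.
exact: (A_equivalent_revolution theta sgam yp i1 j0 d0).2.
Qed.
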